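(* Let $V\in \mathbf{Mod}(\operatorname{Sym}(3),2)$ be faithful and $3$-divisible. Then there is a $\operatorname{Sym}(3)$-module dim-isogeny $\varphi:\operatorname{std}(3,L)\rightarrow V$ for some $1$-dimensional subgroup $L\le V$; further, if $V$ has no elements of order $3$, then $\varphi$ is an isomorphism.
   Context: A modular universe $\mathcal{U}$ is a collection $\mathrm{Ob}(\mathcal U)$ of abelian groups (the modules of $\mathcal U$) together with a collection $\mathrm{Ar}(\mathcal U)$ of group homomorphisms between them (the compatible morphisms), closed under composition, with the following closure properties. (Inverses) If $f\in \mathrm{Ar}(\mathcal U)$ is an isomorphism, then $f^{-1}\in \mathrm{Ar}(\mathcal U)$. (Products) If $V_1,V_2\in \mathrm{Ob}(\mathcal U)$ and $f_1,f_2\in\mathrm{Ar}(\mathcal U)$, then $V_1\times V_2\in\mathrm{Ob}(\mathcal U)$, and $\mathrm{Ar}(\mathcal U)$ contains $f_1\times f_2$, the projections $V_1\times V_2\to V_i$, and the diagonal embeddings $V_1\to V_1^k$. (Sections) If $W\le V$ are in $\mathrm{Ob}(\mathcal U)$, then $V/W\in\mathrm{Ob}(\mathcal U)$ and $\mathrm{Ar}(\mathcal U)$ contains the inclusion $W\to V$ and the quotient map $V\to V/W$. (Kernels/images) If $f:V_1\to V_2$ is in $\mathrm{Ar}(\mathcal U)$, then $\ker f,\operatorname{im} f\in\mathrm{Ob}(\mathcal U)$, and for all $W_1,W_2\in\mathrm{Ob}(\mathcal U)$: if $W_1\le\ker f$, the induced map $V_1/W_1\to V_2$ is in $\mathrm{Ar}(\mathcal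 U)$; if $\operatorname{im} f\le W_2\le V_2$, the induced map $V_1\to W_2$ is in $\mathrm{Ar}(\mathcal U)$. ($\mathbb Z$-module structure) If $V\in\mathrm{Ob}(\mathcal U)$, then $\mathrm{Ar}(\mathcal U)$ contains the sum map $V\times V\to V$ and the multiplication-by-$n$ maps $V\to V$ for $n\in\mathbb{Z}$. An additive dimension on $\mathcal U$ is a function $\dim:\mathrm{Ob}(\mathcal U)\to\mathbb N$ such that $\dim V=\dim\ker f+\dim\operatorname{im} f$ for every $f:V\to W$ in $\mathrm{Ar}(\mathcal U)$. A $G$-module in $\mathcal U$ is a module $V\in\mathrm{Ob}(\mathcal U)$ with an action of the group $G$ by compatible morphisms. Submodules of $V$ are subgroups of $V$ belonging to $\mathrm{Ob}(\mathcal U)$; a $1$-dimensional subgroup $L\le V$ is a submodule with $\dim L=1$. A module $V$ is dim-connected if every proper submodule $W<V$ in $\mathcal U$ satisfies $\dim W<\dim V$. $\mathbf{Mod}(G,d)$ is the class of all dim-connected $G$-modules of dimension exactly $d$, in modular universes with an additive dimension (each module coming with its own universe). An abelian group $V$ is $p$-divisible if for every $v\in V$ there is $w\in V$ with $v=pw$. For an abelian group $L$ (with trivial $\operatorname{Sym}(n)$-action), $\operatorname{perm}(n,\mathbb Z)=\mathbb Ze_1\oplus\cdots\oplus\mathbb Ze_n$ with $\operatorname{Sym}(n)$ permuting the $e_i$ naturally, $\operatorname{std}(n,\mathbb Z)=\{\sum_i c_ie_i : c_i\in\mathbb Z,\ \sum_i c_i=0\}$, and $\operatorname{std}(n,L)=\operatorname{std}(n,\mathbb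 Z)\otimes_{\mathbb Z}L$. When $L\in\mathrm{Ob}(\mathcal U)$, $\operatorname{std}(n,L)$ is regarded as a module of $\mathcal U$ by identifying it with the kernel of the sum map $L^n\to L$. A dim-isogeny is a surjective compatible homomorphism whose kernel has dimension $0$; a $G$-module dim-isogeny is one commuting with the action of $G$. *)

(* Defs.v *)
From HB Require Import structures.
From mathcomp Require Import all_boot all_order all_algebra all_fingroup.
From mathcomp Require Import ring_quotient boolp.

Set Implicit Arguments.
Unset Strict Implicit.
Unset Printing Implicit Defensive.

Import GRing.Theory.

Local Open Scope ring_scope.

(* A module is encoded as a subgroup V : zmodClosed A of an ambient zmodType A.
   W <= V then means: same ambient type and inclusion of the two predicates.
   A morphism V -> W is encoded by a function A -> B of which only the values
   on V matter.  Membership is boolean, but the next two lemmas show that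
   (classically) zmodClosed A is exactly the collection of all subgroups of A,
   with extensional equality.  This is why kernels, images and quotients can be
   described below by quantifying over the zmodClosed with the right elements:
   there is exactly one. *)

Lemma zmodClosed_ext (A : zmodType) (V W : zmodClosed A) : V =i W -> V = W.
Proof.
case: V W => [V cV] [W cW] /= eVW.
have eqVW : V = W by apply/funext => x; exact: eVW.
case: W / eqVW cW {eVW} => cW; congr GRing.ZmodClosed.Pack.
case: cV cW => [[p1] [p2]] [[q1] [q2]].
by rewrite (Prop_irrelevance p1 q1) (Prop_irrelevance p2 q2).
Qed.

Lemma zmodClosed_exists (A : zmodType) (P : A -> Prop) :
  P 0 -> (forall x y, P x -> P y -> P (x - y)) ->
  exists V : zmodClosed A, forall x, x \in V <-> P x.
Proof.
move=> P0 PB; pose S : {pred A} := fun x => `[< P x >].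
have clS : zmod_closed S.
  split=> [|x y /asboolP Px /asboolP Py]; apply/asboolP => //; exact: PB.
pose m := GRing.isZmodClosed.Build A S clS.
pose V : zmodClosed A := HB.pack S m.
by exists V => x; split=> /asboolP.
Qed.

Section Subgroups.
Variables A B : zmodType.
Implicit Types (V : zmodClosed A) (W : zmodClosed B) (f : A -> B).

Definition sub_le (W V : zmodClosed A) : Prop := {subset W <= V}.

Definition hom_on V W f : Prop :=
  {in V, forall x, f x \in W} /\ {in V &, {morph f : x y / x + y}}.

Definition inverse_on V W f (g : B -> A) : Prop :=
  {in V, forall x, g (f x) = x} /\
  {in W, forall y, g y \in V /\ f (g y) = y}.

Definition is_iso V W f : Prop := hom_on V W f /\ exists g, inverse_on V W f g.

Definition is_kernel V f (K : zmodClosed A) : Prop :=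
  forall x, x \in K <-> x \in V /\ f x = 0.

Definition is_image V f (I : zmodClosed B) : Prop :=
  forall y, y \in I <-> exists2 x, x \in V & f x = y.

Definition surj_on V W f : Prop :=
  {in W, forall y, exists2 x, x \in V & f x = y}.

Definition prod_pred V W : {pred A * B} :=
  [pred p | (p.1 \in V) && (p.2 \in W)].

Lemma prod_closed V W : zmod_closed (prod_pred V W).
Proof.
split=> [|p q /andP[p1 p2] /andP[q1 q2]]; apply/andP; split; rewrite ?rpred0 //.
- by rewrite /= rpredB.
- by rewrite /= rpredB.
Qed.

HB.instance Definition _ V W :=
  GRing.isZmodClosed.Build (A * B)%type (prod_pred V W) (prod_closed V W).

Definition prod_sub V W : zmodClosed (A * B)%type := prod_pred V W.

End Subgroups.

Definition qproj (A : zmodType) (W : zmodClosed A) (x : A) : {ideal_quot W} :=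
  (\pi x)%qT.

Lemma qproj_eq (A : zmodType) (W : zmodClosed A) (x y : A) :
  qproj W x = qproj W y <-> x - y \in W.
Proof. by rewrite Quotient.idealrBE; split=> /eqP. Qed.

Lemma qprojD (A : zmodType) (W : zmodClosed A) :
  {morph qproj W : x y / x + y}.
Proof. by move=> x y; exact: (raddfD (\pi_({ideal_quot W}))%qT). Qed.

(* V / W is the subgroup of {ideal_quot W} = A / W formed by the cosets of the
   elements of V. *)
Definition is_quotient (A : zmodType) (V W : zmodClosed A)
    (Q : zmodClosed {ideal_quot W}) : Prop :=
  is_image V (qproj W) Q.

(* npow A k is A^(k+1), bracketed as (A^k) * A; its coordinates are indexed by
   'I_k.+1. *)
Fixpoint npow (A : zmodType) (k : nat) : zmodType :=
  if k is k'.+1 then (npow A k' * A)%type else A.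

Fixpoint npow_sub (A : zmodType) (V : zmodClosed A) (k : nat) :
    zmodClosed (npow A k) :=
  if k is k'.+1 then prod_sub (npow_sub V k') V else V.

Fixpoint coord (A : zmodType) (k : nat) : npow A k -> 'I_k.+1 -> A :=
  if k is k'.+1 then
    fun x i => if unlift ord_max i is Some j then coord x.1 j else x.2
  else fun x _ => x.

Fixpoint of_coord (A : zmodType) (k : nat) : ('I_k.+1 -> A) -> npow A k :=
  if k is k'.+1 then
    fun c => (of_coord (fun j : 'I_k'.+1 => c (lift ord_max j)), c ord_max)
  else fun c => c ord0.

Lemma coordK (A : zmodType) k (c : 'I_k.+1 -> A) : coord (of_coord c) =1 c.
Proof.
elim: k c => [|k IHk] c i /=; first by rewrite [i]ord1.
by case: unliftP => [j|] -> //; rewrite IHk.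
Qed.

Lemma coordB (A : zmodType) k (x y : npow A k) i :
  coord (x - y) i = coord x i - coord y i.
Proof.
elim: k x y i => [|k IHk] x y i //=.
by case: unlift => [j|] //; exact: (IHk x.1 y.1).
Qed.

Lemma coord0 (A : zmodType) k i : coord (0 : npow A k) i = 0.
Proof. by rewrite -(subrr 0) coordB subrr. Qed.

Definition npow_sum (A : zmodType) k (x : npow A k) : A := \sum_i coord x i.

(* std k L is std(k+1, L), as the kernel of the sum map L^(k+1) -> L. *)
Definition std_pred (A : zmodType) k (L : zmodClosed A) : {pred npow A k} :=
  [pred x | (x \in npow_sub L k) && (npow_sum x == 0)].

Arguments std_pred [A] k L _.

Lemma std_closed (A : zmodType) k (L : zmodClosed A) :
  zmod_closed (std_pred k L).
Proof.
split=> [|x y /andP[xL /eqP x0] /andP[yL /eqP y0]]; apply/andP; split.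
- exact: rpred0.
- by apply/eqP/big1 => i _; exact: coord0.
- exact: rpredB.
- rewrite /npow_sum (eq_bigr _ (fun i _ => coordB x y i)) sumrB.
  by rewrite -/(npow_sum x) -/(npow_sum y) x0 y0 subrr.
Qed.

HB.instance Definition _ (A : zmodType) k (L : zmodClosed A) :=
  GRing.isZmodClosed.Build (npow A k) (std_pred k L) (std_closed k L).

Definition std (A : zmodType) k (L : zmodClosed A) : zmodClosed (npow A k) :=
  std_pred k L.

(* s sends e_i to e_(s i), so the i-th coordinate of the image of x is the
   (s^-1 i)-th coordinate of x. *)
Definition perm_act (A : zmodType) k (s : 'S_k.+1) (x : npow A k) : npow A k :=
  of_coord (fun i => coord x ((s^-1)%g i)).

Record modular_universe := ModularUniverse {
  Ob : forall {A : zmodType}, zmodClosed A -> Prop;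
  Ar : forall {A B : zmodType},
    zmodClosed A -> zmodClosed B -> (A -> B) -> Prop;
  Ar_hom : forall (A B : zmodType) (V : zmodClosed A) (W : zmodClosed B) f,
    Ar V W f -> [/\ Ob V, Ob W & hom_on V W f];
  Ar_ext : forall (A B : zmodType) (V : zmodClosed A) (W : zmodClosed B) f g,
    {in V, f =1 g} -> Ar V W f -> Ar V W g;
  Ar_comp : forall (A B C : zmodType) (U : zmodClosed A) (V : zmodClosed B)
      (W : zmodClosed C) f g,
    Ar U V f -> Ar V W g -> Ar U W (fun x => g (f x));
  Ar_inv : forall (A B : zmodType) (V : zmodClosed A) (W : zmodClosed B) f g,
    Ar V W f -> inverse_on V W f g -> Ar W V g;
  Ob_prod : forall (A B : zmodType) (V : zmodClosed A) (W : zmodClosed B),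
    Ob V -> Ob W -> Ob (prod_sub V W);
  Ar_prod : forall (A1 A2 B1 B2 : zmodType)
      (V1 : zmodClosed A1) (V2 : zmodClosed A2)
      (W1 : zmodClosed B1) (W2 : zmodClosed B2) f1 f2,
    Ar V1 W1 f1 -> Ar V2 W2 f2 ->
    Ar (prod_sub V1 V2) (prod_sub W1 W2) (fun p => (f1 p.1, f2 p.2));
  Ar_fst : forall (A B : zmodType) (V : zmodClosed A) (W : zmodClosed B),
    Ob V -> Ob W -> Ar (prod_sub V W) V fst;
  Ar_snd : forall (A B : zmodType) (V : zmodClosed A) (W : zmodClosed B),
    Ob V -> Ob W -> Ar (prod_sub V W) W snd;
  Ar_diag : forall (A : zmodType) (V : zmodClosed A) k,
    Ob V -> Ar V (npow_sub V k) (fun x => of_coord (fun=> x));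
  Ar_incl : forall (A : zmodType) (W V : zmodClosed A),
    Ob W -> Ob V -> sub_le W V -> Ar W V (fun x => x);
  Ob_quot : forall (A : zmodType) (W V : zmodClosed A) (Q : zmodClosed {ideal_quot W}),
    Ob W -> Ob V -> sub_le W V -> is_quotient V Q -> Ob Q;
  Ar_quot : forall (A : zmodType) (W V : zmodClosed A) (Q : zmodClosed {ideal_quot W}),
    Ob W -> Ob V -> sub_le W V -> is_quotient V Q ->
    Ar V Q (qproj W);
  Ob_ker : forall (A B : zmodType) (V : zmodClosed A) (W : zmodClosed B) f K,
    Ar V W f -> is_kernel V f K -> Ob K;
  Ob_im : forall (A B : zmodType) (V : zmodClosed A) (W : zmodClosed B) f I,
    Ar V W f -> is_image V f I -> Ob I;
  Ar_factor : forall (A B : zmodType) (V1 : zmodClosed A) (V2 : zmodClosed B) f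
      (K W1 : zmodClosed A) (Q : zmodClosed {ideal_quot W1}) (g : {ideal_quot W1} -> B),
    Ar V1 V2 f -> is_kernel V1 f K -> Ob W1 -> sub_le W1 K ->
    is_quotient V1 Q -> {in V1, forall x, g (qproj W1 x) = f x} ->
    Ar Q V2 g;
  Ar_corestrict : forall (A B : zmodType) (V1 : zmodClosed A)
      (V2 : zmodClosed B) f (I W2 : zmodClosed B),
    Ar V1 V2 f -> is_image V1 f I -> Ob W2 -> sub_le I W2 -> sub_le W2 V2 ->
    Ar V1 W2 f;
  Ar_sum : forall (A : zmodType) (V : zmodClosed A),
    Ob V -> Ar (prod_sub V V) V (fun p => p.1 + p.2);
  Ar_mulz : forall (A : zmodType) (V : zmodClosed A) (n : int),
    Ob V -> Ar V V (fun x => x *~ n)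
}.

(* Only the values of adim on Ob U are constrained or used. *)
Record additive_dimension (U : modular_universe) := AdditiveDimension {
  adim : forall {A : zmodType}, zmodClosed A -> nat;
  adimD : forall (A B : zmodType) (V : zmodClosed A) (W : zmodClosed B) f K I,
    Ar U V W f -> is_kernel V f K -> is_image V f I ->
    adim V = (adim K + adim I)%N
}.

Section Modules.
Variables (U : modular_universe) (dim : additive_dimension U).

Definition submodule (A : zmodType) (W V : zmodClosed A) : Prop :=
  Ob U W /\ sub_le W V.

Definition dim_connected (A : zmodType) (V : zmodClosed A) : Prop :=
  forall W : zmodClosed A, submodule W V -> ~ sub_le V W ->
  (adim dim W < adim dim V)%N.

(* The product g * h of MathComp permutations is "first g, then h", so actions
   are written as right actions; with the same convention, perm_act is the
   natural action on std (Gmodule_law_std below). *)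
Definition Gmodule_law (G : groupType) (A : zmodType) (V : zmodClosed A)
    (act : G -> A -> A) : Prop :=
  {in V, forall x, act 1%g x = x} /\
  (forall g h, {in V, forall x, act (g * h)%g x = act h (act g x)}).

Definition Gmodule (G : groupType) (A : zmodType) (V : zmodClosed A)
    (act : G -> A -> A) : Prop :=
  [/\ Ob U V, Gmodule_law V act & forall g, Ar U V V (act g)].

Definition Mod (G : groupType) (d : nat) (A : zmodType) (V : zmodClosed A)
    (act : G -> A -> A) : Prop :=
  [/\ Gmodule V act, dim_connected V & adim dim V = d].

Definition faithful_act (G : groupType) (A : zmodType) (V : zmodClosed A)
    (act : G -> A -> A) : Prop :=
  forall g, {in V, forall x, act g x = x} -> g = 1%g.

Definition dim_isogeny (A B : zmodType) (V : zmodClosed A) (W : zmodClosed B)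
    (f : A -> B) : Prop :=
  [/\ Ar U V W f, surj_on V W f &
      forall K, is_kernel V f K -> adim dim K = 0%N].

Definition equivariant (G : groupType) (A B : zmodType) (V : zmodClosed A)
    (actV : G -> A -> A) (actW : G -> B -> B) (f : A -> B) : Prop :=
  forall g, {in V, forall x, f (actV g x) = actW g (f x)}.

End Modules.

Definition p_divisible (p : nat) (A : zmodType) (V : zmodClosed A) : Prop :=
  {in V, forall v, exists2 w, w \in V & v = w *+ p}.

Definition has_order (A : zmodType) (v : A) (n : nat) : Prop :=
  [/\ (0 < n)%N, v *+ n = 0 &
      forall m, (0 < m)%N -> (m < n)%N -> v *+ m <> 0].

Lemma coord_inj (A : zmodType) k (x y : npow A k) : coord x =1 coord y -> x = y.
Proof.
elim: k x y => [|k IHk] /= x y exy; first exact: (exy ord0).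
case: x y exy => [x a] [y b] exy; congr pair.
  by apply: IHk => j; have := exy (lift ord_max j); rewrite /= liftK.
by have := exy ord_max; rewrite unlift_none.
Qed.

Lemma npow_subP (A : zmodType) (V : zmodClosed A) k (x : npow A k) :
  x \in npow_sub V k <-> forall i, coord x i \in V.
Proof.
elim: k x => [|k IHk] /= x; first by split=> // /(_ ord0).
split=> [/andP[/IHk x1 x2] i | xV]; first by case: unlift.
apply/andP; split.
  by apply/IHk => j; have := xV (lift ord_max j); rewrite liftK.
by have := xV ord_max; rewrite unlift_none.
Qed.

Lemma perm_act_std (A : zmodType) k (L : zmodClosed A) (s : 'S_k.+1) :
  {in std k L, forall x, perm_act s x \in std k L}.
Proof.
move=> x /andP[/npow_subP xL /eqP x0]; apply/andP; split.
  by apply/npow_subP => i; rewrite coordK.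
apply/eqP; rewrite -x0 /npow_sum [RHS](reindex_inj (@perm_inj _ (s^-1)%g)).
by apply: eq_bigr => i _; rewrite coordK.
Qed.

Lemma Gmodule_law_std (A : zmodType) k (L : zmodClosed A) :
  Gmodule_law (std k L) (@perm_act A k).
Proof.
split=> [x _ | g h x _]; apply: coord_inj => i; rewrite !coordK.
  by rewrite invg1 perm1.
by rewrite invMg permM.
Qed.

(* Main.v *)
Require Import Defs.
From mathcomp Require Import all_boot all_order all_algebra all_fingroup.
From mathcomp Require Import ring_quotient boolp.

(* Let b be a transposition and c a 3-cycle.  If the trace 1 + c + c^2 does not
   vanish on V, its kernel has dimension at most 1, and it contains the
   dim-connected image of 1 - c, on which b must then act as 1 or -1.  So c acts
   trivially on this image, where 1 + c + c^2 is both 0 and 3; by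
   3-divisibility the image is 0, against faithfulness.  Hence the trace is 0.
   Take L to be the image of 1 + b, which is fixed by b and has dimension 1, and
   phi (x0, x1, x2) = x0 + c x1 + c^2 x2.  This is onto, since for w in V
     3 w = phi (w + b w, c b w + c^2 w, c^2 b w + c w),
   so by counting dimensions its kernel has dimension 0; and applying b to an
   element of the kernel shows that its coordinates are equal up to 3-torsion. *)

Set Implicit Arguments.
Unset Strict Implicit.
Unset Printing Implicit Defensive.

Import GRing.Theory.

Local Open Scope ring_scope.

(** * Homomorphisms on subgroups: kernels, images and inverses *)

Section Homs.
Variables (A B : zmodType) (V : zmodClosed A) (W : zmodClosed B) (f : A -> B).
Hypothesis fV : hom_on V W f.

Lemma hom_on_in : {in V, forall x, f x \in W}. Proof. by case: fV. Qed.

Lemma hom_onD : {in V &, {morph f : x y / x + y}}. Proof. by case: fV. Qed.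

Lemma hom_on0 : f 0 = 0.
Proof. by apply: (addrI (f 0)); rewrite -hom_onD ?rpred0 // !addr0. Qed.

Lemma hom_onN : {in V, {morph f : x / - x}}.
Proof.
by move=> x xV; apply: (addrI (f x)); rewrite -hom_onD ?rpredN // !subrr hom_on0.
Qed.

Lemma hom_onB : {in V &, {morph f : x y / x - y}}.
Proof. by move=> x y xV yV; rewrite hom_onD ?rpredN // hom_onN. Qed.

Lemma hom_onMn n : {in V, {morph f : x / x *+ n}}.
Proof.
move=> x xV; elim: n => [|n IHn]; first by rewrite !mulr0n hom_on0.
by rewrite !mulrS hom_onD ?rpredMn // IHn.
Qed.

Lemma hom_on_sum (I : finType) (F : I -> A) :
  (forall i, F i \in V) -> f (\sum_i F i) = \sum_i f (F i).
Proof.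
move=> FV; elim: (index_enum I) => [|i r IHr]; first by rewrite !big_nil hom_on0.
by rewrite !big_cons hom_onD ?rpred_sum // IHr.
Qed.

Lemma kernel_exists : exists K, is_kernel V f K.
Proof.
apply: zmodClosed_exists => [|x y [xV x0] [yV y0]]; first by rewrite rpred0 hom_on0.
by rewrite rpredB // hom_onB // x0 y0 subrr.
Qed.

Lemma image_exists : exists I, is_image V f I.
Proof.
apply: zmodClosed_exists => [|_ _ [x xV <-] [y yV <-]].
  by exists 0; rewrite ?rpred0 ?hom_on0.
by exists (x - y); rewrite ?rpredB ?hom_onB.
Qed.

Lemma image_sub I : is_image V f I -> sub_le I W.
Proof. by move=> fI y /fI[x xV <-]; exact: hom_on_in. Qed.

End Homs.

Lemma image_surj (A B : zmodType) (V : zmodClosed A) (W : zmodClosed B) f :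
  hom_on V W f -> surj_on V W f -> is_image V f W.
Proof. by move=> fV fs y; split=> [/fs//|[x xV <-]]; exact: (hom_on_in fV). Qed.

Lemma iso_of_bij (A B : zmodType) (V : zmodClosed A) (W : zmodClosed B) f :
  hom_on V W f -> {in V, forall x, f x = 0 -> x = 0} -> surj_on V W f ->
  is_iso V W f.
Proof.
move=> fV finj fs; split=> //.
have [g gP] : {g : B -> A & forall y, y \in W -> g y \in V /\ f (g y) = y}.
  apply: (@choice _ _ (fun y x => y \in W -> x \in V /\ f x = y)) => y.
  (* The inverse comes from choice; off [W] its value is irrelevant and set to [0]. *)
  have [yW|] := boolP (y \in W); last by exists 0.
  by have [x xV fx] := fs y yW; exists x.
exists g; split=> [x xV|y /gP//].
have [gV fg] := gP _ (hom_on_in fV xV).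
apply/subr0_eq/finj; first exact: rpredB.
by rewrite (hom_onB fV) // fg subrr.
Qed.

(** * Compatible morphisms and additive dimension in a modular universe *)

Section Universe.
Variables (U : modular_universe) (dim : additive_dimension U).

Section Morphisms.
Variables (A B : zmodType) (V : zmodClosed A) (W : zmodClosed B).
Implicit Types f g : A -> B.

Lemma Ar_hom_on f : Ar U V W f -> hom_on V W f.
Proof. by case/Ar_hom. Qed.

Lemma Ar_add f g : Ar U V W f -> Ar U V W g -> Ar U V W (fun x => f x + g x).
Proof.
move=> fA gA; have [VO WO _] := Ar_hom fA.
(* Diagonal, then the product of [f] and [g], then the sum map; the exponent is shifted, so
   [npow_sub V 1] is the square of [V]. *)
exact: (Ar_comp (Ar_comp (Ar_diag 1 VO) (Ar_prod fA gA)) (Ar_sum WO)).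
Qed.

Lemma Ar_scale f n : Ar U V W f -> Ar U V W (fun x => f x *~ n).
Proof. by move=> fA; have [_ WO _] := Ar_hom fA; exact: Ar_comp (Ar_mulz n WO). Qed.

Lemma Ar_sub f g : Ar U V W f -> Ar U V W g -> Ar U V W (fun x => f x - g x).
Proof. by move=> fA /(Ar_scale (-1)) gA; have := Ar_add fA gA. Qed.

(** The index [i0] handles the empty sum: the zero map is [0] times [F i0]. *)
Lemma Ar_bigsum (I : finType) (i0 : I) (F : I -> A -> B) :
  (forall i, Ar U V W (F i)) -> Ar U V W (fun x => \sum_i F i x).
Proof.
move=> FA; elim: (index_enum I) => [|i r IHr].
  apply: Ar_ext (Ar_scale 0 (FA i0)) => x _.
  by rewrite big_nil mulr0z.
by apply: Ar_ext (Ar_add (FA i) IHr) => x _; rewrite big_cons.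
Qed.

End Morphisms.

Lemma Ar_id (A : zmodType) (V : zmodClosed A) : Ob U V -> Ar U V V id.
Proof. by move=> VO; exact: Ar_incl. Qed.

(** The identity of [V] has the same kernel as [f], and additivity for the identity forces its
    dimension to be 0. *)
Lemma adim_injective (A B : zmodType) (V : zmodClosed A) (W : zmodClosed B) f I :
  Ar U V W f -> is_image V f I -> {in V, forall x, f x = 0 -> x = 0} ->
  adim dim V = adim dim I.
Proof.
move=> fA fI finj; have [VO _ fh] := Ar_hom fA; have [K fK] := kernel_exists fh.
have idK : is_kernel V id K.
  by move=> x; rewrite fK; split=> -[xV x0]; split=> //;
    [exact: finj | rewrite x0 (hom_on0 fh)].
have idV : is_image V id V by move=> x; split=> [xV|[y yV <-]//]; exists x.
have /eqP := adimD dim (Ar_id VO) idK idV.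
by rewrite -[X in X == _]add0n eqn_add2r (adimD dim fA fK fI) => /eqP <-.
Qed.

Lemma quotient_exists (A : zmodType) (W V : zmodClosed A) :
  Ob U W -> Ob U V -> sub_le W V ->
  exists2 Q : zmodClosed {ideal_quot W}, is_quotient V Q & Ar U V Q (qproj W).
Proof.
move=> WO VO WV; have [||Q QP] := @zmodClosed_exists {ideal_quot W}
    (fun y => exists2 x, x \in V & qproj W x = y).
- by exists 0; [exact: rpred0 | exact: raddf0].
- move=> _ _ [x xV <-] [y yV <-]; exists (x - y); first exact: rpredB.
  exact: (raddfB (\pi_({ideal_quot W}))%qT).
by exists Q => //; exact: Ar_quot.
Qed.

Lemma qproj_eq0 (A : zmodType) (W : zmodClosed A) x : qproj W x = 0 <-> x \in W.
Proof.
rewrite -[x in x \in W]subr0 -qproj_eq; suff -> : qproj W 0 = 0 by [].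
exact: raddf0.
Qed.

(** Additivity for the quotient map V -> V/W, whose kernel is [W]. *)
Lemma adim_le (A : zmodType) (W V : zmodClosed A) :
  Ob U V -> submodule U W V -> (adim dim W <= adim dim V)%N.
Proof.
move=> VO [WO WV]; have [Q QV qA] := quotient_exists WO VO WV.
rewrite (adimD dim qA (K := W) (I := Q)) ?leq_addr // => x.
by rewrite qproj_eq0; split=> [xW|[]//]; split=> //; exact: WV.
Qed.

Lemma dim_connected_eq (A : zmodType) (W V : zmodClosed A) :
  dim_connected dim V -> submodule U W V -> (adim dim V <= adim dim W)%N ->
  sub_le V W.
Proof.
move=> Vc WV; rewrite leqNgt => /negP dW.
by apply: (@contrapT (sub_le V W)) => /(Vc W WV)/dW.
Qed.

(** The kernel has the dimension of [V], so it is all of [V]. *)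
Lemma connected_image0 (A B : zmodType) (V : zmodClosed A) (W : zmodClosed B) f I :
  dim_connected dim V -> Ar U V W f -> is_image V f I -> adim dim I = 0%N ->
  {in V, forall x, f x = 0}.
Proof.
move=> Vc fA fI I0 x xV; have [K fK] := kernel_exists (Ar_hom_on fA).
suff /(_ x xV)/fK[] : sub_le V K by [].
apply: dim_connected_eq => //.
  by split; [exact: Ob_ker fA fK | move=> y /fK[]].
by rewrite (adimD dim fA fK fI) I0 addn0.
Qed.

(* The image of a dim-connected module is dim-connected: pull [J] back to [V]. *)
Lemma connected_image_eq (A B : zmodType) (V : zmodClosed A) (W : zmodClosed B)
    f I J :
  dim_connected dim V -> Ar U V W f -> is_image V f I -> submodule U J I ->
  (adim dim I <= adim dim J)%N -> sub_le I J.
Proof.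
move=> Vc fA fI [JO JI] IJ; have [VO WO fh] := Ar_hom fA.
have [K fK] := kernel_exists fh.
(* The preimage [P] of [J] lies in the universe as the kernel of V -> W -> W/J. *)
have [Q _ qA] := quotient_exists JO WO (fun y yJ => image_sub fh fI (JI y yJ)).
have fqA := Ar_comp fA qA; have [P PP] := kernel_exists (Ar_hom_on fqA).
have PE x : x \in P <-> x \in V /\ f x \in J by rewrite PP qproj_eq0.
have PV : submodule U P V by split; [exact: Ob_ker fqA PP | move=> x /PE[]].
have PA := Ar_comp (Ar_incl PV.1 VO PV.2) fA.
have PK : is_kernel P f K.
  move=> x; rewrite fK PE; split=> [[xV x0]|[[xV _] x0]] //.
  by rewrite x0 rpred0.
have PJ : is_image P f J.
  move=> y; split=> [yJ|[x /PE[_ fxJ] <-]//].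
  by have /fI[x xV fx] := JI y yJ; exists x => //; apply/PE; rewrite fx.
(* On [P] as on [V] the kernel of [f] is [K], so dim P = dim K + dim J >= dim V. *)
have VP : sub_le V P.
  apply: dim_connected_eq => //.
  by rewrite (adimD dim fA fK fI) (adimD dim PA PK PJ) leq_add2l.
by move=> y /fI[x /VP/PE[_ fxJ] <-].
Qed.

(** The second projection maps the kernel of the first one bijectively onto [W]. *)
Lemma adim_prod (A B : zmodType) (V : zmodClosed A) (W : zmodClosed B) :
  Ob U V -> Ob U W -> adim dim (prod_sub V W) = (adim dim V + adim dim W)%N.
Proof.
move=> VO WO; have fA := Ar_fst VO WO; have sA := Ar_snd VO WO.
have [K fK] := kernel_exists (Ar_hom_on fA).
have KE p : p \in K <-> p.1 = 0 /\ p.2 \in W.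
  rewrite fK; split=> [[/andP[_ p2] ->]//|[p1 p2]]; split=> //.
  by apply/andP; rewrite p1 rpred0.
have fV : is_image (prod_sub V W) fst V.
  apply: image_surj (Ar_hom_on fA) _ => x xV; exists (x, 0) => //.
  by apply/andP; rewrite rpred0.
rewrite (adimD dim fA fK fV) addnC; congr addn.
have KV : sub_le K (prod_sub V W) by move=> p /fK[].
have iA := Ar_incl (Ob_ker fA fK) (Ob_prod VO WO) KV.
apply: (adim_injective (Ar_comp iA sA)) => [y|p /KE[p1 _] p2].
  split=> [yW|[p /KE[_ pW] <-]//]; exists (0, y) => //; exact/KE.
by rewrite [p]surjective_pairing p1 p2.
Qed.

(** * Powers of a module and the standard modules *)

Section Powers.
Variables (A : zmodType) (V : zmodClosed A).
Hypothesis VO : Ob U V.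

Lemma Ob_npow k : Ob U (npow_sub V k).
Proof. by elim: k => //= k IHk; exact: Ob_prod. Qed.

Lemma adim_npow k : adim dim (npow_sub V k) = (k.+1 * adim dim V)%N.
Proof.
elim: k => [|k IHk]; first by rewrite mul1n.
by rewrite [LHS](adim_prod (Ob_npow k) VO) IHk [RHS]mulSn addnC.
Qed.

Lemma Ar_coord k i : Ar U (npow_sub V k) V (fun x => Defs.coord x i).
Proof.
elim: k i => [|k IHk] i; first exact: Ar_id.
rewrite /=; case: unliftP => [j|] _; last exact: (Ar_snd (Ob_npow k) VO).
exact: (Ar_comp (Ar_fst (Ob_npow k) VO) (IHk j)).
Qed.

Lemma Ar_npow_sum k : Ar U (npow_sub V k) V (@npow_sum A k).
Proof. by apply: (Ar_bigsum ord0) => i; exact: Ar_coord. Qed.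

Lemma std_kernel k : is_kernel (npow_sub V k) (@npow_sum A k) (std k V).
Proof. by move=> x; split=> [/andP[xV /eqP x0]|[xV x0]] //; apply/andP; rewrite x0. Qed.

Lemma Ob_std k : Ob U (std k V).
Proof. exact: Ob_ker (@Ar_npow_sum k) (@std_kernel k). Qed.

Lemma Ar_coord_std k i : Ar U (std k V) V (fun x => Defs.coord x i).
Proof.
apply: Ar_comp (Ar_incl (Ob_std k) (Ob_npow k) _) (@Ar_coord _ i).
by move=> x /andP[].
Qed.

(** The sum map from the (k+1)-st power is onto: (x, 0, ..., 0) is sent to x. *)
Lemma adim_std k : adim dim (std k V) = (k * adim dim V)%N.
Proof.
have: is_image (npow_sub V k) (@npow_sum A k) V.
  apply: image_surj (Ar_hom_on (@Ar_npow_sum k)) _ => x xV.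
  exists (of_coord (fun i => if i == ord0 then x else 0)).
    by apply/npow_subP => i; rewrite coordK; case: ifP; rewrite ?rpred0.
  rewrite /npow_sum (bigD1 ord0) //= big1 => [|i /negPf i0].
    by rewrite coordK eqxx addr0.
  by rewrite coordK i0.
move/(adimD dim (@Ar_npow_sum k) (@std_kernel k))/eqP.
by rewrite adim_npow mulSn addnC eqn_add2r eq_sym => /eqP.
Qed.

End Powers.
End Universe.

(** If 3y = 0 and y is nonzero, the order is exactly 3, since 2y = 0 would give y = 3y = 0. *)
Lemma torsion3_free (A : zmodType) (V : zmodClosed A) y :
  ~ (exists2 v, v \in V & has_order v 3) ->
  y \in V -> y *+ 3 = 0 -> y = 0.
Proof.
move=> no3 yV y3; apply: contrapT => yn0; apply: no3; exists y => //.
split=> // -[|[|[|m]]] // _ _ y2; apply: yn0.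
by rewrite -y3 mulrSr y2 add0r.
Qed.

(** * An involution [b] inverting a nontrivial [c] of order 3, in dimension 2 *)

Section Dihedral.
Variables (U : modular_universe) (dim : additive_dimension U).
Variables (A : zmodType) (V : zmodClosed A) (b c : A -> A).
Hypotheses (bA : Ar U V V b) (cA : Ar U V V c).
Hypotheses (b2 : {in V, forall x, b (b x) = x}).
Hypotheses (c3 : {in V, forall x, c (c (c x)) = x}).
Hypotheses (bc : {in V, forall x, b (c x) = c (c (b x))}).
Hypotheses (Vc : dim_connected dim V) (V2 : adim dim V = 2%N).
Hypotheses (V3 : p_divisible 3 V) (c_neq1 : ~ {in V, forall x, c x = x}).

Let VO : Ob U V. Proof. by have [] := Ar_hom bA. Qed.
Let bh : hom_on V V b := Ar_hom_on bA.
Let ch : hom_on V V c := Ar_hom_on cA.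
Let bV x : x \in V -> b x \in V. Proof. exact: (hom_on_in bh). Qed.
Let cV x : x \in V -> c x \in V. Proof. exact: (hom_on_in ch). Qed.

Ltac in_V := solve [ assumption | apply: bV; in_V | apply: cV; in_V
  | apply: rpredD; in_V | rewrite rpredN; in_V | apply: rpredMn; in_V ].

Let bD x y : x \in V -> y \in V -> b (x + y) = b x + b y.
Proof. exact: (hom_onD bh). Qed.
Let bN x : x \in V -> b (- x) = - b x. Proof. exact: (hom_onN bh). Qed.
Let cD x y : x \in V -> y \in V -> c (x + y) = c x + c y.
Proof. exact: (hom_onD ch). Qed.
Let cN x : x \in V -> c (- x) = - c x. Proof. exact: (hom_onN ch). Qed.

Let cc_fixed y : y \in V -> c y = c (c y) -> y = c y.
Proof. by move=> yV cy; rewrite -[LHS]c3 // -[X in X = _]/(c _) -cy -cy. Qed.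

(** (1 + c + c^2)(1 - c) = 1 - c^3. *)
Let trace_sub x : x \in V ->
  x - c x + c (x - c x) + c (c (x - c x)) = 0.
Proof.
move=> xV; rewrite !(cD, cN, c3) //; try in_V.
by rewrite [x - _ + _]addrA subrK addrA subrK subrr.
Qed.

(* Otherwise the image of 1 - c lies in the kernel of 1 + c + c^2, so it has
   dimension at most 1; being dim-connected and stable under b, it is either
   killed by 1 - b or equal to its own image under 1 - b. *)
Lemma trace_or_reflection_scalar :
  {in V, forall x, x + c x + c (c x) = 0} \/
  {in V, forall x, b (x - c x) = x - c x} \/
  {in V, forall x, b (x - c x) = - (x - c x)}.
Proof.
pose N x := x + c x + c (c x); pose D x := x - c x.
have NA : Ar U V V N := Ar_add (Ar_add (Ar_id VO) cA) (Ar_comp cA cA).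
have DA : Ar U V V D := Ar_sub (Ar_id VO) cA.
have DV x : x \in V -> D x \in V by move=> xV; rewrite /D; in_V.
have FA : Ar U V V (fun x => D x - b (D x)) := Ar_sub DA (Ar_comp DA bA).
have [K NK] := kernel_exists (Ar_hom_on NA).
have [I NI] := image_exists (Ar_hom_on NA).
have [J DJ] := image_exists (Ar_hom_on DA).
have [J' FJ'] := image_exists (Ar_hom_on FA).
have [I0|I_gt0] := posnP (adim dim I).
  by left; exact: (connected_image0 Vc NA NI I0).
right; have J_le1 : (adim dim J <= 1)%N.
  have: (adim dim J <= adim dim K)%N.
    apply: (adim_le dim (Ob_ker NA NK)); split; first exact: Ob_im DA DJ.
    move=> _ /DJ[x xV <-]; apply/NK; split; first exact: DV.
    exact: trace_sub.
  move/leq_trans; apply.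
  by rewrite -(leq_add2r (adim dim I)) -(adimD dim NA NK NI) V2.
have J'J : submodule U J' J.
  split; first exact: Ob_im FA FJ'.
  (* The witness comes from b(1 - c) = (1 - c^2)b = (1 - c)(1 + c)b. *)
  move=> _ /FJ'[x xV <-]; apply/DJ; exists (x - (b x + c (b x))); first by in_V.
  rewrite /D !(cD, cN, bD, bN, bc); try in_V.
  by rewrite !(opprD, opprK) [LHS]addrACA; congr (_ + _); rewrite addrA subrK.
have [F0|F_gt0] := posnP (adim dim J').
  left=> x xV; apply/esym/subr0_eq.
  exact: (connected_image0 Vc FA FJ' F0 xV).
(* Now [J'] is all of [J], and [b] negates it because b(1 - b) = -(1 - b). *)
have JJ' := connected_image_eq Vc DA DJ J'J (leq_trans J_le1 F_gt0).
right=> x xV; have /JJ'/FJ'[y yV] : D x \in J by apply/DJ; exists x.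
rewrite -/(D x) => <-; have DyV := DV y yV.
by rewrite bD ?bN ?b2 ?opprB //; in_V.
Qed.

Lemma trace_eq0 : {in V, forall x, x + c x + c (c x) = 0}.
Proof.
have [//|bS] := trace_or_reflection_scalar; case: c_neq1 => x xV.
have [w wV ->] := V3 xV; have dV : w - c w \in V by in_V.
have cdE : c (w - c w) = c w - c (c w) by rewrite cD ?cN //; in_V.
(* Let d = w - c w. Both d and c d lie in the image of 1 - c, where [b] is one fixed sign, so b c d
   = c^2 b d gives c d = c^2 d. *)
have cd : w - c w = c (w - c w).
  apply: cc_fixed => //.
  have := bc dV; rewrite {1}cdE; case: bS => bS; rewrite !bS ?cN -?cdE //; try in_V.
  exact: oppr_inj.
(* As c d = d, the vanishing trace of d is 3d = 3w - c(3w), so [c] fixes x = 3w. *)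
rewrite (hom_onMn ch) //; apply/esym/subr0_eq; rewrite -mulrnBl !mulrS mulr0n addr0.
by rewrite -[RHS](trace_sub wV) -!cd addrA.
Qed.

(** Dimension 0 would give b = -1, and dimension 2 would give b = 1, as [b] fixes [L]. A scalar [b]
    commutes with [c], so b c = c^2 b would force c = 1. *)
Lemma adim_fixed_image L : is_image V (fun x => x + b x) L -> adim dim L = 1%N.
Proof.
have FA : Ar U V V (fun x => x + b x) := Ar_add (Ar_id VO) bA.
move=> FL; have LV : submodule U L V.
  split; first exact: Ob_im FA FL.
  by move=> _ /FL[x xV <-]; in_V.
have := adim_le dim VO LV; rewrite V2.
case L2 : (adim dim L) => [|[|[|//]]] // _; case: c_neq1 => x xV.
  have bNx y : y \in V -> b y = - y.
    by move=> yV; apply/esym/addr0_eq; rewrite (connected_image0 Vc FA FL).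
  apply/esym/cc_fixed => //; apply: oppr_inj.
  by rewrite -bNx ?bc ?bNx ?cN //; in_V.
have b1 y : y \in V -> b y = y.
  move=> yV; have /FL[z zV <-] : y \in L.
    by apply: (dim_connected_eq Vc LV) => //; rewrite V2 L2.
  by rewrite bD ?b2 1?addrC //; in_V.
by apply/esym/cc_fixed => //; rewrite -[LHS]b1 ?bc ?b1 //; in_V.
Qed.

Section Induced.
Variable L : zmodClosed A.
Hypothesis FL : is_image V (fun x => x + b x) L.

Lemma induced_surj :
  {in V, forall v, exists x0 x1 x2,
    [/\ [/\ x0 \in L, x1 \in L & x2 \in L], x0 + x1 + x2 = 0 &
        x0 + c x1 + c (c x2) = v]}.
Proof.
move=> v vV; have [w wV ->] := V3 vV.
(* These are w, c^2 w and c w plus their images under b. *)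
exists (w + b w), (c (b w) + c (c w)), (c (c (b w)) + c w).
have N0 := trace_eq0; have bwV := bV wV.
split.
- split; apply/FL; first by exists w.
    by exists (c (b w)); [in_V | rewrite bc ?b2 //; in_V].
  by exists (c (c (b w))); [in_V | rewrite bc ?bc ?b2 ?c3 //; in_V].
(* The coordinates add up to the trace of w plus the trace of b w. *)
- rewrite -[RHS](addr0 0) -{1}(N0 _ wV) -(N0 _ bwV).
  by rewrite +%R.[AC (2*2*2) (1*6*4*(2*3*5))].
(* Since c^3 = 1, the value is 3w plus the trace of b w. *)
rewrite !cD ?c3; try in_V.
rewrite +%R.[AC (2*2*2) (1*4*6*(2*5*3))] N0 // addr0.
by rewrite !mulrS mulr0n addr0 addrA.
Qed.

Lemma induced_inj x0 x1 x2 :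
  ~ (exists2 v, v \in V & has_order v 3) ->
  x0 \in L -> x1 \in L -> x2 \in L -> x0 + x1 + x2 = 0 ->
  x0 + c x1 + c (c x2) = 0 -> [/\ x0 = 0, x1 = 0 & x2 = 0].
Proof.
have LV x : x \in L -> x \in V /\ b x = x.
  move=> /FL[z zV <-]; split; first by in_V.
  by rewrite bD ?b2 1?addrC //; in_V.
move=> no3 /LV[x0V b0] /LV[x1V b1] /LV[x2V b2'] x_sum phi0.
pose u := x0 - x2; pose y := x1 - x2.
have uV : u \in V by rewrite /u; in_V.
have yV : y \in V by rewrite /y; in_V.
(* Subtract the vanishing trace of [x2] from [phi0]. *)
have uy : u + c y = 0.
  rewrite /u /y cD ?cN; try in_V.
  rewrite addrACA -[X in X + _](addrK (c (c x2))) phi0 add0r.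
  by rewrite -!opprD [X in - X]addrC trace_eq0 // oppr0.
(* Apply [b] to [uy]: it fixes u and y and turns c y into c^2 y. *)
have uyy : u + c (c y) = 0.
  have byy : b y = y by rewrite /y bD ?bN ?b1 ?b2' //; in_V.
  have bu : b u = u by rewrite /u bD ?bN ?b0 ?b2' //; in_V.
  by rewrite -(hom_on0 bh) -uy bD ?bu ?bc ?byy //; in_V.
have y_fixed : y = c y by apply: cc_fixed => //; apply: (addrI u); rewrite uy.
have y0 : y = 0.
  apply: (torsion3_free no3) => //; rewrite -[RHS](trace_eq0 yV) -!y_fixed.
  by rewrite !mulrS mulr0n addr0 addrA.
have u0 : u = 0 by rewrite -uy -y_fixed y0 addr0.
have x02 : x0 = x2 by exact: subr0_eq.
have x12 : x1 = x2 by exact: subr0_eq.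
(* The coordinates are equal and sum to 0, so 3 [x2] = 0. *)
suff x2_0 : x2 = 0 by rewrite x02 x12.
apply: (torsion3_free no3) => //; rewrite -[RHS]x_sum x02 x12.
by rewrite !mulrS mulr0n addr0 addrA.
Qed.

End Induced.
End Dihedral.

(** * Generators and relations of Sym(3) *)

Definition ord3_1 : 'I_3 := lift ord0 ord0.
(** Nested [lift]s are the form in which [big_ord_recl] produces the indices. *)
Definition ord3_2 : 'I_3 := lift ord0 (lift ord0 ord0).
Definition refl3 : 'S_3 := tperm ord3_1 ord3_2.
(** Products compose from left to right: this is the cycle 0 -> 1 -> 2 -> 0. *)
Definition rot3 : 'S_3 := (refl3 * tperm ord0 ord3_1)%g.

Lemma ord3P (P : 'I_3 -> Prop) : P ord0 -> P ord3_1 -> P ord3_2 -> forall i, P i.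
Proof.
move=> P0 P1 P2 [[|[|[|//]]] lti].
- by rewrite (_ : Ordinal lti = ord0) //; exact: val_inj.
- by rewrite (_ : Ordinal lti = ord3_1) //; exact: val_inj.
- by rewrite (_ : Ordinal lti = ord3_2) //; exact: val_inj.
Qed.

Lemma refl3K : (refl3 * refl3 = 1)%g.
Proof. exact: tperm2. Qed.

Lemma rot3_cube : (rot3 * rot3 * rot3 = 1)%g.
Proof.
by apply/permP; apply: ord3P; do ?rewrite (permM, permE) /=.
Qed.

(** For a right action this reads b c = c^2 b. *)
Lemma rot3_refl3 : (rot3 * refl3 = refl3 * (rot3 * rot3))%g.
Proof.
by apply/permP; apply: ord3P; do ?rewrite (permM, permE) /=.
Qed.

Lemma stab3_ord0 (k : 'S_3) : k ord0 = ord0 -> k = 1%g \/ k = refl3.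
Proof.
move=> k0; have kinj := @perm_inj _ k.
(* Naming the images of 1 and 2 allows a case analysis on them; injectivity leaves two cases. *)
suff E a1 a2 : k ord3_1 = a1 -> k ord3_2 = a2 ->
    a1 <> ord0 -> a2 <> ord0 -> a1 <> a2 ->
    k = 1%g \/ k = refl3.
  apply: (E _ _ erefl erefl); last by move/kinj/eqP.
    by rewrite -[X in _ <> X]k0 => /kinj/eqP.
  by rewrite -[X in _ <> X]k0 => /kinj/eqP.
elim/ord3P: a1; elim/ord3P: a2 => // k1 k2 _ _ _; [left | right].
  by apply/permP; apply: ord3P; rewrite ?k0 ?k1 ?k2 !permE.
by apply/permP; apply: ord3P; rewrite ?k0 ?k1 ?k2 !permE.
Qed.

(** * The action of Sym(3) on vectors fixed by [refl3] *)

Section Action.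
Variables (A : zmodType) (V : zmodClosed A) (act : 'S_3 -> A -> A).
Hypothesis actV : Gmodule_law V act.

(** g h^-1 stabilizes 0, so it is 1 or [refl3] and fixes y. *)
Lemma act_fixed_eq (g h : 'S_3) y : y \in V -> act refl3 y = y ->
  g ord0 = h ord0 -> act g y = act h y.
Proof.
move=> yV yb gh; have [act1 actM] := actV.
have : (g * h^-1)%g ord0 = ord0 by rewrite permM gh permK.
rewrite -[g in act g _](mulgKV h) => /stab3_ord0[] ->; rewrite actM // ?yb //.
by rewrite act1.
Qed.

(** The transposition of 0 and i may be replaced by the i-th power of [rot3]: both send 0 to i. *)
Lemma sum_act_fixed (y : 'I_3 -> A) :
  (forall i, y i \in V) -> (forall i, act refl3 (y i) = y i) ->
  \sum_i act (tperm ord0 i) (y i) =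
  y ord0 + act rot3 (y ord3_1) + act rot3 (act rot3 (y ord3_2)).
Proof.
move=> yV yb; have [act1 actM] := actV.
rewrite !big_ord_recl big_ord0 addr0 addrA tperm1 act1 // -actM //.
congr (_ + _ + _); apply: act_fixed_eq => //; rewrite ?permM tpermL.
  by do ?rewrite (permM, permE) /=.
by do ?rewrite (permM, permE) /=.
Qed.

End Action.

Theorem lemma4p6 (U : modular_universe) (dim : additive_dimension U)
    (A : zmodType) (V : zmodClosed A) (act : 'S_3 -> A -> A) :
  Mod dim 2 V act ->
  faithful_act V act ->
  p_divisible 3 V ->
  exists L : zmodClosed A,
    [/\ submodule U L V, adim dim L = 1%N &
     exists phi : npow A 2 -> A,
       [/\ dim_isogeny dim (std 2 L) V phi,
           equivariant (std 2 L) (@perm_act A 2) act phi &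
           (~ exists2 v : A, v \in V & has_order v 3) ->
           is_iso (std 2 L) V phi]].
Proof.
move=> [[VO actV actA] Vc V2] Vf V3; have [act1 actM] := actV.
pose b := act refl3; pose c := act rot3.
have bA : Ar U V V b := actA _.
have cA : Ar U V V c := actA _.
have bV := hom_on_in (Ar_hom_on bA).
have cV := hom_on_in (Ar_hom_on cA).
have b2 : {in V, forall x, b (b x) = x}.
  by move=> x xV; rewrite /b -actM // refl3K act1.
have c3 : {in V, forall x, c (c (c x)) = x}.
  by move=> x xV; rewrite /c -[act _ (act _ x)]actM // -actM // rot3_cube act1.
have bc : {in V, forall x, b (c x) = c (c (b x))}.
  move=> x xV; rewrite /b /c -[LHS]actM // rot3_refl3.
  by rewrite [LHS]actM // [LHS]actM //; exact: bV.
have c_neq1 : ~ {in V, forall x, c x = x}.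
  by move=> /Vf/permP/(_ ord0); rewrite !permE /= !permE.
have SA : Ar U V V (fun x => x + b x) := Ar_add (Ar_id VO) bA.
have [L SL] := image_exists (Ar_hom_on SA).
have LO : Ob U L := Ob_im SA SL.
have LV : sub_le L V := image_sub (Ar_hom_on SA) SL.
have L1 : adim dim L = 1%N := adim_fixed_image bA cA b2 c3 bc Vc V2 c_neq1 SL.
have Lb y : y \in L -> b y = y.
  move=> /SL[x xV <-]; rewrite (hom_onD (Ar_hom_on bA)) ?bV // b2 //.
  exact: addrC.
(* Writing the map with transpositions treats all indices alike, which makes equivariance a
   reindexing. *)
pose phi (x : npow A 2) := \sum_i act (tperm ord0 i) (Defs.coord x i).
have stdL x i : x \in std 2 L -> Defs.coord x i \in L.
  by move=> /andP[/npow_subP].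
have phiE x : x \in std 2 L -> phi x =
    Defs.coord x ord0 + c (Defs.coord x ord3_1) + c (c (Defs.coord x ord3_2)).
  move=> xL; apply: (sum_act_fixed actV (y := Defs.coord x)) => i;
    [exact/LV/stdL | exact/Lb/stdL].
have stdE x : npow_sum x =
    Defs.coord x ord0 + Defs.coord x ord3_1 + Defs.coord x ord3_2 :> A.
  by rewrite /npow_sum !big_ord_recl big_ord0 addr0 addrA.
have phiA : Ar U (std 2 L) V phi.
  apply: (Ar_bigsum ord0) => i.
  exact: Ar_comp (Ar_comp (Ar_coord_std LO i) (Ar_incl LO VO LV)) (actA _).
have phi_surj : surj_on (std 2 L) V phi.
  move=> v /(induced_surj bA cA b2 c3 bc Vc V2 V3 c_neq1 SL).
  move=> [x0 [x1 [x2 [[x0L x1L x2L] x_sum <-]]]].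
  pose x : npow A 2 := of_coord (fun i : 'I_3 => nth 0 [:: x0; x1; x2] i).
  have xE i : Defs.coord x i = nth 0 [:: x0; x1; x2] i by rewrite coordK.
  have xL : x \in std 2 L.
    apply/andP; split; last by apply/eqP; rewrite stdE !xE.
    by apply/npow_subP; apply: ord3P; rewrite xE.
  by exists x => //; rewrite phiE // !xE.
exists L; split=> //; exists phi; split.
(* Source and target both have dimension 2. *)
- split=> // K phiK; have := adim_std dim LO 2.
  rewrite (adimD dim phiA phiK (image_surj (Ar_hom_on phiA) phi_surj)) V2 L1.
  by case: (adim dim K) => [|k] //; rewrite addn2.
- move=> g x xL; rewrite /phi (hom_on_sum (Ar_hom_on (actA g))); last first.
    by move=> i; apply: (hom_on_in (Ar_hom_on (actA _))); exact/LV/stdL.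
  (* After the substitution of g i for i, the two permutations acting on the i-th coordinate both
     send 0 to g i. *)
  rewrite (reindex_inj (@perm_inj _ g)); apply: eq_bigr => i _.
  rewrite coordK permK -actM; last exact/LV/stdL.
  apply: (act_fixed_eq actV); [exact/LV/stdL | exact/Lb/stdL |].
  by rewrite permM !tpermL.
- move=> no3; apply: iso_of_bij (Ar_hom_on phiA) _ phi_surj => x xL phi0.
  have /andP[_ /eqP] := xL; rewrite stdE => x_sum; rewrite phiE // in phi0.
  have [] := induced_inj bA cA b2 c3 bc Vc V2 V3 c_neq1 SL no3
    (stdL _ _ xL) (stdL _ _ xL) (stdL _ _ xL) x_sum phi0.
  by move=> x0 x1 x2; apply: coord_inj => i; rewrite Defs.coord0; elim/ord3P: i.
Qed.
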